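(* Consider the Kreiss constant $\mathcal{K}$, either in its continuous-time version $\mathcal{K}_{c}$ or its discrete-time version $\mathcal{K}_{d}$, as a function $A \mapsto \mathcal{K}(A)\in[1,\infty]$ on $\mathbb{C}^{n\times n}$. (i) $\mathcal{K}$ is not always continuous at $A$, as it may instantaneously jump to/from $\infty$: for each of the two versions there exist a matrix $A$ with $\mathcal{K}(A)<\infty$ and a sequence of matrices $A_k\to A$ with $\mathcal{K}(A_k)=\infty$ for all $k$. (ii) If $\alpha(A)<0$, then the continuous-time Kreiss constant $\mathcal{K}_{c}$ is continuous at $A$. If $\rho(A)<1$, then the discrete-time Kreiss constant $\mathcal{K}_{d}$ is continuous at $A$.
   Context: $\|\cdot\|$ is the spectral norm; $\alpha(A)=\max\{\mathrm{Re}\,\lambda:\lambda\in\Lambda(A)\}$ is the spectral abscissa and $\rho(A)=\max\{|\lambda|:\lambda\in\Lambda(A)\}$ the spectral radius, where $\Lambda(A)$ is the spectrum. For $A\in\mathbb{C}^{n\times n}$ the continuous-time Kreiss constant is $$\mathcal{K}_c(A)=\sup_{z\in\mathbb{C},\ \mathrm{Re}\,z>0}(\mathrm{Re}\,z)\,\|(zI-A)^{-1}\|,$$ and the discrete-time Kreiss constant is $$\mathcal{K}_d(A)=\sup_{z\in\mathbb{C},\ |z|>1}(|z|-1)\,\|(zI-A)^{-1}\|,$$ with the convention $\|(zI-A)^{-1}\|=\infty$ if $z\in\Lambda(A)$. Both take values in $[1,\infty]$. *)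

(* Defs.v *)
From HB Require Import structures.
From mathcomp Require Import all_boot all_order all_algebra complex.
From mathcomp Require Import all_classical all_reals all_analysis.

Set Implicit Arguments.
Unset Strict Implicit.
Unset Printing Implicit Defensive.

Import Order.TTheory GRing.Theory Num.Theory numFieldNormedType.Exports.

Local Open Scope classical_set_scope.
Local Open Scope ring_scope.

(* MathComp-Analysis puts the modulus topology on any abstract numFieldType,
   but its canonical instances are not found for the concrete type R[i].
   Through this instance 'M[R[i]]_n gets the library's entrywise topology,
   which is the norm topology. *)
#[export, non_forgetful_inheritance]
HB.instance Definition _ (R : rcfType) := PseudoMetric.copy R[i] R[i]^o.

Section Kreiss.
Variable R : realType.
Implicit Types (n : nat) (z : R[i]).

Definition euclidean_norm n (x : 'cV[R[i]]_n) : R :=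
  Num.sqrt (\sum_(i < n) Normc.normc (x i 0) ^+ 2).

Definition spectral_norm n (M : 'M[R[i]]_n) : R :=
  sup [set euclidean_norm (M *m x) | x in [set x | euclidean_norm x <= 1]].

Definition spectrum n (A : 'M[R[i]]_n) : set R[i] := [set z | eigenvalue A z].

(* For 0 < n the spectrum is finite and nonempty, so these suprema are maxima. *)
Definition spectral_abscissa n (A : 'M[R[i]]_n) : R :=
  sup [set complex.Re z | z in spectrum A].

Definition spectral_radius n (A : 'M[R[i]]_n) : R :=
  sup [set Normc.normc z | z in spectrum A].

Definition resolvent_norm n (A : 'M[R[i]]_n) z : \bar R :=
  if eigenvalue A z then +oo%E else (spectral_norm (invmx (z%:M - A)))%:E.

Definition kreissC n (A : 'M[R[i]]_n) : \bar R :=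
  ereal_sup [set ((complex.Re z)%:E * resolvent_norm A z)%E
            | z in [set z | 0 < complex.Re z]].

Definition kreissD n (A : 'M[R[i]]_n) : \bar R :=
  ereal_sup [set ((Normc.normc z - 1)%:E * resolvent_norm A z)%E
            | z in [set z | 1 < Normc.normc z]].

Definition jumps_to_infinity n (K : 'M[R[i]]_n -> \bar R) (A : 'M[R[i]]_n) :=
  (K A < +oo)%E /\
  exists A_ : nat -> 'M[R[i]]_n,
    A_ k @[k --> \oo] --> A /\ forall k, K (A_ k) = +oo%E.

End Kreiss.

(* Main.v *)
(** If every eigenvalue of [A] stays at distance at least [d > 0] from the
    domain of the supremum, the resolvent is bounded there by some [M], and the
    resolvent identity
      [(z - B)^-1 - (z - A)^-1 = (z - B)^-1 (B - A) (z - A)^-1]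
    compares [||(z - A)^-1||] and [||(z - B)^-1||] up to factors [1 +- t] with
    [t = ||B - A|| M], uniformly in [z]. So the two suprema are within the
    same factors, whatever the weight. For the jumps, perturb [0] (resp. [1])
    to [0 + 1/k] (resp. [1 + 1/k]). *)
Require Import Defs.
From mathcomp Require Import all_boot all_order all_algebra complex.
From mathcomp Require Import all_classical all_reals all_analysis.
From mathcomp Require Import ring lra.
Import Order.TTheory GRing.Theory Num.Theory numFieldNormedType.Exports.
Local Open Scope classical_set_scope.
Local Open Scope ring_scope.

(** * Euclidean and spectral norms on complex vectors and matrices *)

Section EuclideanNorm.
Set Implicit Arguments.
Unset Strict Implicit.
Variable R : realType.
Local Notation normc := (@Normc.normc R).

Lemma normc_ge0 (z : R[i]) : 0 <= normc z.
Proof. by case: z => a b /=; exact: sqrtr_ge0. Qed.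

Lemma normr_normc (z : R[i]) : `|z| = (normc z)%:C%C.
Proof. by case: z. Qed.

Lemma normc_sum (I : Type) (r : seq I) (F : I -> R[i]) :
  normc (\sum_(i <- r) F i) <= \sum_(i <- r) normc (F i).
Proof.
apply: (big_ind2 (fun z c => normc z <= c)) => //.
  by rewrite Normc.normc0.
by move=> x1 x2 y1 y2 lx ly; rewrite (le_trans (le_normcD _ _))// lerD.
Qed.

Lemma normcB_ge (x y : R[i]) : normc x - normc y <= normc (x - y).
Proof. by rewrite lerBlDr -{1}(subrK y x) le_normcD. Qed.

Lemma ler_Re_normc (z : R[i]) : complex.Re z <= normc z.
Proof.
case: z => a b /=; rewrite (le_trans (ler_norm a))//.
by rewrite -sqrtr_sqr ler_wsqrtr// lerDl sqr_ge0.
Qed.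

Variable n : nat.
Implicit Types (x y : 'cV[R[i]]_n) (M N : 'M[R[i]]_n).

Lemma euclidean_norm_ge0 x : 0 <= euclidean_norm x.
Proof. exact: sqrtr_ge0. Qed.

Lemma sqr_euclidean_norm x :
  euclidean_norm x ^+ 2 = \sum_(i < n) normc (x i 0) ^+ 2.
Proof. by rewrite sqr_sqrtr// sumr_ge0// => i _; rewrite sqr_ge0. Qed.

Lemma euclidean_norm0 : @euclidean_norm R n 0 = 0.
Proof.
rewrite /euclidean_norm big1 ?sqrtr0// => i _.
by rewrite mxE Normc.normc0 expr0n.
Qed.

Lemma normc_le_euclidean_norm x i : normc (x i 0) <= euclidean_norm x.
Proof.
rewrite -[leLHS]ger0_norm ?normc_ge0// -sqrtr_sqr ler_wsqrtr// (bigD1 i)//=.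
by rewrite lerDl sumr_ge0// => j _; rewrite sqr_ge0.
Qed.

Lemma euclidean_norm0_eq0 x : euclidean_norm x = 0 -> x = 0.
Proof.
move=> x0; apply/colP => i; rewrite mxE; apply: Normc.eq0_normc.
apply/eqP; rewrite eq_le normc_ge0 andbT -x0.
exact: normc_le_euclidean_norm.
Qed.

Lemma euclidean_normZ a x :
  euclidean_norm (a *: x) = normc a * euclidean_norm x.
Proof.
rewrite /euclidean_norm -[X in X * _]ger0_norm ?normc_ge0// -sqrtr_sqr.
rewrite -sqrtrM ?sqr_ge0// mulr_sumr; congr Num.sqrt.
by apply: eq_bigr => i _; rewrite mxE Normc.normcM exprMn.
Qed.

(** Weighted AM-GM in each coordinate: with [a] and [b] the two norms, [u * v] is at most
    [(b / a * u ^+ 2 + a / b * v ^+ 2) / 2], and these bounds sum to exactly [a * b]. Zero vectors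
    are treated apart because of the divisions. *)
Lemma cauchy_schwarz_normc x y :
  \sum_(i < n) normc (x i 0) * normc (y i 0) <=
  euclidean_norm x * euclidean_norm y.
Proof.
have [/euclidean_norm0_eq0 ->|x0] := eqVneq (euclidean_norm x) 0.
  rewrite euclidean_norm0 mul0r big1// => i _.
  by rewrite mxE Normc.normc0 mul0r.
have [/euclidean_norm0_eq0 ->|y0] := eqVneq (euclidean_norm y) 0.
  rewrite euclidean_norm0 mulr0 big1// => i _.
  by rewrite mxE Normc.normc0 mulr0.
set a := euclidean_norm x in x0 *; set b := euclidean_norm y in y0 *.
have agt0 : 0 < a by rewrite lt_neqAle eq_sym x0 euclidean_norm_ge0.
have bgt0 : 0 < b by rewrite lt_neqAle eq_sym y0 euclidean_norm_ge0.
have -> : a * b = \sum_(i < n)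
    (b / a * normc (x i 0) ^+ 2 + a / b * normc (y i 0) ^+ 2) / 2.
  rewrite -mulr_suml big_split/= -!mulr_sumr -!sqr_euclidean_norm -/a -/b.
  by field; rewrite x0 y0.
apply: ler_sum => i _; set u := normc _; set v := normc _.
rewrite -subr_ge0.
have -> : (b / a * u ^+ 2 + a / b * v ^+ 2) / 2 - u * v =
    (b * u - a * v) ^+ 2 / (2 * a * b) by field; rewrite x0 y0.
by rewrite divr_ge0 ?sqr_ge0// !mulr_ge0// ltW.
Qed.

Lemma euclidean_normD x y :
  euclidean_norm (x + y) <= euclidean_norm x + euclidean_norm y.
Proof.
rewrite -(@ler_pXn2r _ 2)// ?nnegrE ?addr_ge0 ?euclidean_norm_ge0//.
rewrite sqr_euclidean_norm sqrrD !sqr_euclidean_norm.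
apply: (@le_trans _ _ (\sum_(i < n) (normc (x i 0) + normc (y i 0)) ^+ 2)).
  apply: ler_sum => i _; rewrite mxE ler_pXn2r// ?nnegrE ?addr_ge0 ?normc_ge0//.
  exact: le_normcD.
under eq_bigr do rewrite sqrrD.
rewrite !big_split/= lerD2r lerD2l mulr2n.
by rewrite lerD ?cauchy_schwarz_normc.
Qed.

Lemma euclidean_norm_sum (I : Type) (r : seq I) (F : I -> 'cV[R[i]]_n) :
  euclidean_norm (\sum_(i <- r) F i) <= \sum_(i <- r) euclidean_norm (F i).
Proof.
apply: (big_ind2 (fun x c => euclidean_norm x <= c)) => //.
  by rewrite euclidean_norm0.
by move=> x1 x2 y1 y2 lx ly; rewrite (le_trans (euclidean_normD _ _))// lerD.
Qed.

Lemma euclidean_norm_le_entries x c : (forall i, normc (x i 0) <= c) ->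
  euclidean_norm x <= c *+ n.
Proof.
move=> xc.
have -> : x = \sum_(i < n) x i 0 *: delta_mx i 0.
  by rewrite [LHS]matrix_sum_delta; apply: eq_bigr => i _; rewrite big_ord1.
rewrite (le_trans (euclidean_norm_sum _ _))//.
have -> : c *+ n = \sum_(i < n) c by rewrite sumr_const card_ord.
apply: ler_sum => i _; rewrite euclidean_normZ.
suff -> : euclidean_norm (delta_mx i 0 : 'cV[R[i]]_n) = 1 by rewrite mulr1.
rewrite /euclidean_norm (bigD1 i)//= big1 => [|j ji].
  by rewrite mxE !eqxx Normc.normc1 expr1n addr0 sqrtr1.
by rewrite mxE (negbTE ji) Normc.normc0 expr0n.
Qed.

(** A supremum-free form of an upper bound on the operator norm; the sign of [c] is left open. *)
Definition opnorm_bound M c := forall x,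
  euclidean_norm (M *m x) <= c * euclidean_norm x.

Lemma opnorm_bound_entries M c : 0 <= c -> (forall i j, normc (M i j) <= c) ->
  opnorm_bound M (c *+ n *+ n).
Proof.
move=> c0 Mc x; rewrite !mulrnAl; apply: euclidean_norm_le_entries => i.
rewrite mxE (le_trans (normc_sum _ _))//.
have -> : (c * euclidean_norm x) *+ n = \sum_(j < n) c * euclidean_norm x.
  by rewrite sumr_const card_ord.
apply: ler_sum => j _; rewrite Normc.normcM.
by rewrite ler_pM ?normc_ge0 ?normc_le_euclidean_norm.
Qed.

(** Makes the set in [spectral_norm] bounded, so that its [sup] is a genuine supremum and not a
    default value. *)
Lemma opnorm_bound_exists M : exists c, opnorm_bound M c.
Proof.
exists ((\sum_i \sum_j normc (M i j)) *+ n *+ n); apply: opnorm_bound_entries.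
  by rewrite !sumr_ge0// => i _; rewrite sumr_ge0// => j _; rewrite normc_ge0.
move=> i j; rewrite (bigD1 i)//= (bigD1 j)//= -addrA lerDl addr_ge0//.
  by rewrite sumr_ge0// => k _; rewrite normc_ge0.
rewrite sumr_ge0// => k _; rewrite sumr_ge0// => l _; exact: normc_ge0.
Qed.

Lemma spectral_norm_le M c : 0 <= c -> opnorm_bound M c -> spectral_norm M <= c.
Proof.
move=> c0 Mc; apply: ge_sup.
  by exists (euclidean_norm (M *m 0)), 0 => //=; rewrite euclidean_norm0.
move=> _ [x /= x1 <-]; rewrite (le_trans (Mc x))//.
by rewrite -[leRHS]mulr1 ler_wpM2l.
Qed.

Lemma spectral_norm_unit M x : euclidean_norm x <= 1 ->
  euclidean_norm (M *m x) <= spectral_norm M.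
Proof.
move=> x1; apply: ub_le_sup; last by exists x.
have [c Mc] := opnorm_bound_exists M.
(* The absolute value is taken because [c] may be negative when [n] is 0. *)
exists `|c| => _ [y /= y1 <-]; rewrite (le_trans (Mc y))//.
rewrite (le_trans (ler_norm _))// normrM -[leRHS]mulr1 ler_wpM2l//.
by rewrite ger0_norm ?euclidean_norm_ge0.
Qed.

Lemma spectral_norm_ge0 M : 0 <= spectral_norm M.
Proof.
rewrite (le_trans _ (@spectral_norm_unit M 0 _))// ?euclidean_norm_ge0//.
by rewrite euclidean_norm0.
Qed.

Lemma spectral_norm_bound M : opnorm_bound M (spectral_norm M).
Proof.
move=> x; have [/euclidean_norm0_eq0 ->|x0] := eqVneq (euclidean_norm x) 0.
  by rewrite mulmx0 euclidean_norm0 mulr0.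
have xgt0 : 0 < euclidean_norm x by rewrite lt_neqAle eq_sym x0 euclidean_norm_ge0.
have nV : normc ((euclidean_norm x)^-1%:C)%C = (euclidean_norm x)^-1.
  by rewrite /= expr0n addr0 sqrtr_sqr ger0_norm// invr_ge0 ltW.
rewrite -ler_pdivrMr// mulrC -nV -euclidean_normZ scalemxAr.
by apply: spectral_norm_unit; rewrite euclidean_normZ nV mulVf.
Qed.

Lemma spectral_normD M N : spectral_norm (M + N) <= spectral_norm M + spectral_norm N.
Proof.
apply: spectral_norm_le => [|x]; first by rewrite addr_ge0 ?spectral_norm_ge0.
rewrite mulmxDl mulrDl (le_trans (euclidean_normD _ _))//.
by rewrite lerD ?spectral_norm_bound.
Qed.

Lemma spectral_normM M N : spectral_norm (M *m N) <= spectral_norm M * spectral_norm N.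
Proof.
apply: spectral_norm_le => [|x]; first by rewrite mulr_ge0 ?spectral_norm_ge0.
rewrite -mulmxA (le_trans (spectral_norm_bound _ _))// -mulrA.
by rewrite ler_wpM2l ?spectral_norm_ge0 ?spectral_norm_bound.
Qed.

Lemma spectral_normZ_le a M : spectral_norm (a *: M) <= normc a * spectral_norm M.
Proof.
apply: spectral_norm_le => [|x]; first by rewrite mulr_ge0 ?normc_ge0 ?spectral_norm_ge0.
rewrite -scalemxAl euclidean_normZ -mulrA.
by rewrite ler_wpM2l ?normc_ge0 ?spectral_norm_bound.
Qed.

Lemma spectral_normN M : spectral_norm (- M) = spectral_norm M.
Proof.
have le N : spectral_norm (- N) <= spectral_norm N.
  by rewrite -scaleN1r (le_trans (spectral_normZ_le _ _))// normcN Normc.normc1 mul1r.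
by apply/eqP; rewrite eq_le le/= -{1}(opprK M) le.
Qed.

Lemma spectral_norm0 : @spectral_norm R n 0 = 0.
Proof.
apply/eqP; rewrite eq_le spectral_norm_ge0 andbT spectral_norm_le// => x.
by rewrite mul0mx euclidean_norm0 mul0r.
Qed.

Lemma spectral_norm1_le : @spectral_norm R n 1%:M <= 1.
Proof. by apply: spectral_norm_le => // x; rewrite mul1mx mul1r. Qed.

(** No Neumann series: a kernel vector of [1%:M - M] is fixed by [M], which strictly shrinks every
    nonzero vector. The transpose turns the row kernel [kermx] into a statement about columns. *)
Lemma unitmx_sub1 M : spectral_norm M < 1 -> 1%:M - M \in unitmx.
Proof.
move=> M1; rewrite -unitmx_tr -row_free_unit -kermx_eq0; apply/rowV0P => v.
move=> /sub_kermxP vM.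
have xM : M *m v^T = v^T.
  apply/esym/eqP; rewrite -subr_eq0 -{1}[v^T]mul1mx -mulmxBl.
  by rewrite -trmx0 -vM trmx_mul trmxK.
apply: trmx_inj; rewrite trmx0; apply: euclidean_norm0_eq0.
have := spectral_norm_bound M v^T; rewrite xM.
have := euclidean_norm_ge0 v^T; nra.
Qed.

Lemma eigenvalueNunit M z : eigenvalue M z = (z%:M - M \notin unitmx).
Proof.
rewrite /eigenvalue kermx_eq0 row_free_unit -opprB -scaleN1r.
by rewrite unitmxZ// unitrN unitr1.
Qed.

(** Links the entrywise topology on matrices to the spectral norm. *)
Lemma near_spectral_norm M e : 0 < e -> \forall N \near M, spectral_norm (N - M) <= e.
Proof.
(* Entries of modulus at most [d] give operator norm at most [n * n] times [d]; the successor keeps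
   the denominator nonzero for [n = 0]. *)
move=> e0; pose d : R := e / (n * n).+1%:R.
have d0 : 0 < d by rewrite divr_gt0.
apply/nbhs_ballP; exists d%:C%C => /=; first by rewrite ltcR.
move=> N MN; apply: spectral_norm_le; first exact: ltW.
move=> x; have /opnorm_bound_entries-/(_ (ltW d0) x) : 
    forall i j, normc ((N - M) i j) <= d.
  move=> i j; have [_ /(_ i j)] := MN.
  rewrite /ball/= normr_normc ltcR !mxE => /ltW.
  by rewrite -normcN opprB.
move=> /le_trans; apply; rewrite ler_wpM2r ?euclidean_norm_ge0//.
rewrite -mulrnA -mulr_natr /d -mulrA -[leRHS]mulr1 ler_wpM2l ?(ltW e0)//.
by rewrite ler_pdivrMl// mulr1 ler_nat.
Qed.

End EuclideanNorm.

(** * Uniform resolvent bounds and perturbation of inverses *)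

Section Resolvent.
Set Implicit Arguments.
Unset Strict Implicit.
Variable R : realType.
Local Notation normc := (@Normc.normc R).

(** If [normc z] exceeds the norm of [A], then [z%:M - A] is [z] times [1%:M - z^-1 *: A], which
    [unitmx_sub1] inverts. *)
Lemma eigenvalue_le_spectral_norm n (A : 'M[R[i]]_n) z :
  eigenvalue A z -> normc z <= spectral_norm A.
Proof.
rewrite eigenvalueNunit leNgt; apply: contra => Az.
have z0 : z != 0.
  apply: contraTneq Az => ->; rewrite Normc.normc0 -leNgt.
  exact: spectral_norm_ge0.
have -> : z%:M - A = z *: (1%:M - z^-1 *: A).
  by rewrite scalerBr scalemx1 scalerA divff// scale1r.
rewrite unitmxZ ?unitfE// unitmx_sub1//.
rewrite (le_lt_trans (spectral_normZ_le _ _))// Normc.normcV.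
rewrite ltr_pdivrMl ?mulr1//.
exact: le_lt_trans (spectral_norm_ge0 A) Az.
Qed.

(* Newton interpolation of [x |-> (z - x)^-1] at the nodes [s], evaluated at
   [A]; by Cayley-Hamilton the remainder vanishes once [s] lists the roots of
   the characteristic polynomial. *)
Lemma resolvent_newton n (A : 'M[R[i]]_n.+1) (s : seq R[i]) (d : R) : 0 < d ->
  exists2 M, 0 <= M &
  forall z, (forall l, l \in s -> d <= normc (z - l)) ->
  exists X, [/\ X *m (z%:M - A) = 1%:M - (\prod_(l <- s) (z - l))^-1 *:
                  horner_mx A (\prod_(l <- s) ('X - l%:P)),
    spectral_norm X <= M &
    forall w, 0 <= w -> (forall l, l \in s -> w <= normc (z - l)) ->
      w * spectral_norm X <= M].
Proof.
move=> d0; elim: s => [|l s [M M0 IH]].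
  exists 0 => // z _; exists 0; rewrite spectral_norm0; split => // [|w _ _].
    by rewrite !big_nil (rmorph1 (horner_mx A)) invr1 scale1r mul0mx subrr.
  by rewrite mulr0.
(* [C] bounds [1%:M + (A - l%:M) *m X]. Dividing by [z - l] leaves at most [d^-1 * C] unweighted and
   at most [C] after multiplication by [w], so the sum of the two serves for both bounds. *)
pose C := 1 + spectral_norm (A - l%:M) * M.
have C0 : 0 <= C by rewrite addr_ge0// mulr_ge0 ?spectral_norm_ge0.
exists (C + d^-1 * C); first by rewrite addr_ge0// mulr_ge0// invr_ge0 ltW.
move=> z zs.
have [X [XE XM _]] := IH z (fun k ks => zs k (@mem_behead _ (l :: s) k ks)).
have dl : d <= normc (z - l) by apply: zs; exact: mem_head.
have l0 : 0 < normc (z - l) by exact: lt_le_trans dl.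
have zl0 : z - l != 0 by apply: contraTneq l0 => ->; rewrite Normc.normc0 ltxx.
have YC : spectral_norm ((z - l)^-1 *: (1%:M + (A - l%:M) *m X)) <=
    (normc (z - l))^-1 * C.
  rewrite (le_trans (spectral_normZ_le _ _))// Normc.normcV.
  rewrite ler_wpM2l ?invr_ge0 ?normc_ge0//.
  rewrite (le_trans (spectral_normD _ _))// lerD ?spectral_norm1_le//.
  rewrite (le_trans (spectral_normM _ _))//.
  by rewrite ler_wpM2l ?spectral_norm_ge0.
(* Since [z - A = (z - l) - (A - l)], this choice cancels all but the old remainder, multiplied by
   [(A - l) / (z - l)]. The weighted bound uses only the new node [l], not the weighted bound of the
   induction. *)
exists ((z - l)^-1 *: (1%:M + (A - l%:M) *m X)); split.
- rewrite -scalemxAl mulmxDl mul1mx -mulmxA XE !big_cons rmorphM/=.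
  rewrite rmorphB/= horner_mx_X horner_mx_C mulmxBr mulmx1 -scalemxAr.
  rewrite !addrA subrK scalerBr scalerA -invfM -[z%:M]scalemx1 -[l%:M]scalemx1.
  by rewrite -scalerBl scalerA mulVf// scale1r.
- rewrite (le_trans YC)// -[leLHS]add0r lerD// ler_wpM2r//.
  by rewrite lef_pV2.
- move=> w w0 /(_ l (mem_head _ _)) wl.
  rewrite (le_trans (ler_wpM2l w0 YC))// -[leLHS]addr0 lerD//; last first.
    by rewrite mulr_ge0// invr_ge0 ltW.
  by rewrite mulrA ler_piMl// ler_pdivrMr// mul1r.
Qed.

(** One [M] serves all [z] at distance [d] from the spectrum, an unbounded region. The last bound
    also controls weights that grow with [z]. With the roots of the characteristic polynomial as
    nodes, the interpolant is the inverse itself. *)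
Lemma resolvent_bounded n (A : 'M[R[i]]_n.+1) (d : R) : 0 < d ->
  exists2 M, 0 <= M &
  forall z, (forall l, eigenvalue A l -> d <= normc (z - l)) ->
    [/\ z%:M - A \in unitmx, spectral_norm (invmx (z%:M - A)) <= M &
    forall w, 0 <= w -> (forall l, eigenvalue A l -> w <= normc (z - l)) ->
      w * spectral_norm (invmx (z%:M - A)) <= M].
Proof.
move=> d0; have [s] := closed_field_poly_normal (char_poly A).
rewrite (monicP (char_poly_monic A)) scale1r => sE.
have sP l : eigenvalue A l = (l \in s).
  by rewrite eigenvalue_root_char sE root_prod_XsubC.
have [M M0 AM] := @resolvent_newton n A s d d0.
exists M => // z dz.
have [|X []] := AM z; first by move=> l ls; apply: dz; rewrite sP.
rewrite -sE Cayley_Hamilton scaler0 subr0 => XE XM wX.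
have [_ zA] := mulmx1_unit XE.
have -> : invmx (z%:M - A) = X by rewrite -[RHS](mulmxK zA) XE mul1mx.
by split => // w w0 wz; apply: wX => // l ls; apply: wz; rewrite sP.
Qed.

Lemma invmx_sub n (X Y : 'M[R[i]]_n) : X \in unitmx -> Y \in unitmx ->
  invmx Y - invmx X = invmx Y *m (X - Y) *m invmx X.
Proof. by move=> Xu Yu; rewrite mulmxBr mulVmx// mulmxBl mulmxK// mul1mx. Qed.

(** [Y] factors as [(1%:M - (X - Y) *m invmx X) *m X], hence is invertible. By [invmx_sub] the
    inverses then differ by at most [t] times the norm of [invmx Y], and the triangle inequality
    gives both comparisons. *)
Lemma unitmx_perturb n (X Y : 'M[R[i]]_n) (t : R) : X \in unitmx ->
  spectral_norm (X - Y) * spectral_norm (invmx X) <= t -> t < 1 ->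
  [/\ Y \in unitmx, (1 - t) * spectral_norm (invmx Y) <= spectral_norm (invmx X) &
    spectral_norm (invmx X) <= (1 + t) * spectral_norm (invmx Y)].
Proof.
move=> Xu XYt t1.
have Yu : Y \in unitmx.
  have -> : Y = (1%:M - (X - Y) *m invmx X) *m X.
    by rewrite mulmxBl mulmxKV// mul1mx opprB addrC subrK.
  rewrite unitmx_mul Xu andbT unitmx_sub1//.
  by rewrite (le_lt_trans _ t1)// (le_trans (spectral_normM _ _)).
have E := @invmx_sub n X Y Xu Yu.
have XYn : spectral_norm (invmx Y *m (X - Y) *m invmx X) <=
    t * spectral_norm (invmx Y).
  rewrite -mulmxA (le_trans (spectral_normM _ _))// mulrC.
  rewrite ler_wpM2r ?spectral_norm_ge0// (le_trans _ XYt)//.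
  exact: spectral_normM.
split => //.
- rewrite mulrBl mul1r lerBlDr -{1}(subrK (invmx X) (invmx Y)) E addrC.
  by rewrite (le_trans (spectral_normD _ _))// lerD2l.
- rewrite mulrDl mul1r.
  have -> : invmx X = invmx Y - invmx Y *m (X - Y) *m invmx X.
    by rewrite -E subKr.
  by rewrite (le_trans (spectral_normD _ _))// spectral_normN lerD2l.
Qed.

End Resolvent.

(** * Suprema of weighted resolvent norms: continuity and jumps *)

Section WeightedResolventSup.
Set Implicit Arguments.
Unset Strict Implicit.
Variable R : realType.
Local Notation normc := (@Normc.normc R).
Variables (D : set R[i]) (w : R[i] -> R).

(** [kreissC] and [kreissD] are both instances of this by conversion, so each argument is made
    once. *)
Definition weighted_resolvent_sup n (A : 'M[R[i]]_n) : \bar R :=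
  ereal_sup [set ((w z)%:E * resolvent_norm A z)%E | z in D].

Lemma weighted_resolvent_sup_ub n (A : 'M[R[i]]_n) z :
  z%:M - A \in unitmx -> D z ->
  ((w z * spectral_norm (invmx (z%:M - A)))%:E <= weighted_resolvent_sup A)%E.
Proof.
move=> zA Dz; apply: ereal_sup_ubound; exists z => //.
by rewrite /resolvent_norm eigenvalueNunit zA.
Qed.

Lemma weighted_resolvent_sup_le n (A : 'M[R[i]]_n) c :
  (forall z, D z -> z%:M - A \in unitmx /\
    w z * spectral_norm (invmx (z%:M - A)) <= c) ->
  (weighted_resolvent_sup A <= c%:E)%E.
Proof.
move=> Ac; apply: ge_ereal_sup => _ [z /= /Ac[zA zc] <-].
by rewrite /resolvent_norm eigenvalueNunit zA -EFinM lee_fin.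
Qed.

(** A point of [D] is required because the supremum of the empty set is [-oo]. *)
Lemma weighted_resolvent_sup_fin n (A : 'M[R[i]]_n) c : D !=set0 ->
  (forall z, D z -> 0 <= w z) ->
  (forall z, D z -> z%:M - A \in unitmx /\
    w z * spectral_norm (invmx (z%:M - A)) <= c) ->
  exists2 k, 0 <= k & weighted_resolvent_sup A = k%:E.
Proof.
move=> [z Dz] w0 Ac.
have Kle := @weighted_resolvent_sup_le n A c Ac.
have Kge : (0 <= weighted_resolvent_sup A)%E.
  rewrite (le_trans _ (@weighted_resolvent_sup_ub n A z _ Dz))//.
    by rewrite lee_fin mulr_ge0 ?w0 ?spectral_norm_ge0.
  by have [] := Ac z Dz.
exists (fine (weighted_resolvent_sup A)); first exact: fine_ge0.
rewrite fineK// ge0_fin_numE//.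
exact: le_lt_trans Kle (ltry _).
Qed.

(** The gap [d] bounds the resolvent uniformly on [D], so one smallness condition on [B - A] works
    for all [z]; the bound of [w] by the distance to the spectrum makes the supremum finite. *)
Lemma continuous_weighted_resolvent_sup n (A : 'M[R[i]]_n.+1) d : 0 < d ->
  D !=set0 -> (forall z, D z -> 0 <= w z) ->
  (forall z l, D z -> eigenvalue A l -> d <= normc (z - l)) ->
  (forall z l, D z -> eigenvalue A l -> w z <= normc (z - l)) ->
  {for A, continuous (@weighted_resolvent_sup n.+1)}.
Proof.
move=> d0 D0 w0 dD wD.
have [M M0 AM] := @resolvent_bounded R n A d d0.
have AM' z : D z -> [/\ z%:M - A \in unitmx, spectral_norm (invmx (z%:M - A)) <= M
    & w z * spectral_norm (invmx (z%:M - A)) <= M].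
  move=> Dz; have [zA zM wM] := AM z (fun l => dD z l Dz).
  by split => //; apply: wM => [|l]; [exact: w0|exact: wD].
have [k k0 kE] : exists2 k, 0 <= k & weighted_resolvent_sup A = k%:E.
  by apply: (@weighted_resolvent_sup_fin n.+1 A M) => // z /AM'[].
(* The radius [t / (M + 1)] makes the norm of [B - A] times that of the resolvent at most [t], and
   [M + 1] is positive even if [M = 0]. *)
have perturb t B : 0 < t -> t <= 2^-1 ->
    spectral_norm (B - A) <= t / (M + 1) ->
    exists b, [/\ weighted_resolvent_sup B = b%:E, (1 - t) * b <= k &
      k <= (1 + t) * b].
  move=> t0 t2 BA.
  have t1 : t < 1 by lra.
  have zB z : D z -> [/\ z%:M - B \in unitmx,
      (1 - t) * spectral_norm (invmx (z%:M - B)) <=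
        spectral_norm (invmx (z%:M - A)) &
      spectral_norm (invmx (z%:M - A)) <=
        (1 + t) * spectral_norm (invmx (z%:M - B))].
    move=> /AM'[zA zM _]; apply: unitmx_perturb => //.
    have -> : z%:M - A - (z%:M - B) = B - A by rewrite opprB addrC addrA subrK.
    rewrite (le_trans (ler_pM _ _ BA zM)) ?spectral_norm_ge0//.
    rewrite mulrAC ler_pdivrMr ?ltr_wpDl//.
    by rewrite ler_wpM2l ?(ltW t0)// lerDl.
  have BleK z : D z -> w z * spectral_norm (invmx (z%:M - B)) <= (1 - t)^-1 * k.
    move=> Dz; have [_ Bz _] := zB z Dz.
    rewrite ler_pdivlMl ?subr_gt0// mulrCA.
    rewrite (le_trans (ler_wpM2l (w0 z Dz) Bz))// -lee_fin -kE.
    by apply: weighted_resolvent_sup_ub => //; have [] := AM' z Dz.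
  have [b b0 bE] : exists2 b, 0 <= b & weighted_resolvent_sup B = b%:E.
    apply: (@weighted_resolvent_sup_fin n.+1 B ((1 - t)^-1 * k)) => // z Dz.
    by have [? _ _] := zB z Dz; split => //; exact: BleK.
  exists b; split => //.
    rewrite -ler_pdivlMl ?subr_gt0// -lee_fin -bE.
    apply: weighted_resolvent_sup_le => z Dz.
    by have [? _ _] := zB z Dz; split => //; exact: BleK.
  rewrite -lee_fin -kE; apply: weighted_resolvent_sup_le => z Dz.
  have [zA _ _] := AM' z Dz; have [Bu _ Bz] := zB z Dz.
  split => //; rewrite (le_trans (ler_wpM2l (w0 z Dz) Bz))// mulrCA.
  rewrite ler_wpM2l ?addr_ge0 ?(ltW t0)// -lee_fin -bE.
  exact: weighted_resolvent_sup_ub.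
have near_perturb t : 0 < t -> \forall B \near A, spectral_norm (B - A) <= t / (M + 1).
  by move=> t0; apply: near_spectral_norm; rewrite divr_gt0// ltr_wpDl.
suff : weighted_resolvent_sup B @[B --> A] --> k%:E by rewrite -kE.
(* Convergence to a finite extended real splits into finiteness near [A], for which [t = 2^-1] is
   enough, and convergence of the real parts [fine]. *)
apply/(@fine_cvgP _ _ (nbhs A) _ (@weighted_resolvent_sup n.+1) k); split.
  have h0 : (0 : R) < 2^-1 by rewrite invr_gt0.
  apply: filterS (near_perturb _ h0) => B BA.
  by have [b [bE _ _]] := perturb _ B h0 (lexx _) BA; rewrite bE.
apply/cvgrPdist_le => e e0.
(* With [t] at most [2^-1], [(1 - t) * b <= k] gives [b <= 2 * k]; hence [k] and [b] differ by at
   most [t * b <= 2 * k * t <= e]. *)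
pose t := Num.min 2^-1 (e / (2 * (k + 1))).
have t0 : 0 < t by rewrite lt_min invr_gt0 divr_gt0 ?mulr_gt0 ?ltr_wpDl.
have t2 : t <= 2^-1 by rewrite ge_min lexx.
have te : t * (2 * (k + 1)) <= e.
  by rewrite -ler_pdivlMr ?mulr_gt0 ?ltr_wpDl// ge_min lexx orbT.
apply: filterS (near_perturb t t0) => B BA.
have [b [bE b1 b2]] := perturb t B t0 t2 BA.
have b0 : 0 <= b by rewrite -(pmulr_rge0 _ (ltr_pwDl ltr01 (ltW t0))) (le_trans k0).
have b2k : b <= 2 * k by nra.
have tb : t * b <= t * (2 * k) by rewrite ler_wpM2l ?(ltW t0).
rewrite /= bE/= ler_norml; apply/andP; split; nra.
Qed.

(** Continuity would make the constant sequence [+oo] converge to [K A], so that [K A = +oo] by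
    uniqueness of limits. *)
Lemma jumps_to_infinity_discontinuous n (K : 'M[R[i]]_n -> \bar R) A :
  jumps_to_infinity K A -> ~ {for A, continuous K}.
Proof.
move=> [KA [A_ [A_A KA_]]] Kc.
have : K (A_ k) @[k --> \oo] --> K A by exact: (cvg_comp A_ K A_A Kc).
under eq_fun do rewrite KA_.
move=> /(cvg_lim (@ereal_hausdorff R)); rewrite lim_cst//.
by move=> KE; rewrite -KE ltxx in KA.
Qed.

(** The resolvent of [a%:M] is the scalar matrix of [(z - a)^-1], so a weight below [normc (z - a)]
    keeps the supremum at most 1, while any positive real shift of [a] puts an eigenvalue inside
    [D]. *)
Lemma scalar_mx_jumps_to_infinity n (a : R[i]) : (0 < n)%N ->
  (forall z, D z -> 0 < normc (z - a) /\ w z <= normc (z - a)) ->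
  (forall e : R, 0 < e -> D (a + e%:C%C) /\ 0 < w (a + e%:C%C)) ->
  jumps_to_infinity (@weighted_resolvent_sup n) a%:M.
Proof.
move=> n0 Da De; split.
  apply: (@le_lt_trans _ _ 1%:E); last exact: ltry.
  apply: weighted_resolvent_sup_le => z /Da[za0 wza].
  have za : z - a != 0 by apply: contraTneq za0 => ->; rewrite Normc.normc0 ltxx.
  rewrite -[z%:M]scalemx1 -[a%:M]scalemx1 -scalerBl; split.
    by rewrite unitmxZ ?unitfE// unitmx1.
  rewrite invmxZ ?unitmx1 ?unitmxZ ?unitfE ?unitmx1// invmx1.
  have zn : spectral_norm ((z - a)^-1 *: (1%:M : 'M[R[i]]_n)) <= (normc (z - a))^-1.
    rewrite (le_trans (spectral_normZ_le _ _))// Normc.normcV.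
    by rewrite -[leRHS]mulr1 ler_wpM2l ?spectral_norm1_le// invr_ge0 ltW.
  rewrite (le_trans (ler_wpM2r (spectral_norm_ge0 _) wza))//.
  by rewrite (le_trans (ler_wpM2l (ltW za0) zn))// divff ?gt_eqF.
pose u k : R[i] := a + (k.+1%:R^-1 : R)%:C%C.
exists (fun k => (u k)%:M); split.
  apply/cvg_ballP => -[e i]; rewrite ltcE/= => /andP[/eqP -> e0].
  have := near_infty_natSinv_lt (PosNum e0); apply: filterS => k /= ke.
  split; first by rewrite ltcR.
  move=> j l; rewrite !mxE /ball/= -mulrnBl opprD addrA subrr sub0r.
  case: (j == l); last by rewrite mulr0n normr0 ltcR.
  by rewrite mulr1n normrN normr_normc ltcR/= expr0n addr0 sqrtr_sqr ger0_norm.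
move=> k; have [Du wu] : D (u k) /\ 0 < w (u k) by apply: De; rewrite invr_gt0.
apply/eqP; rewrite -leye_eq; apply: ereal_sup_ubound; exists (u k) => //.
rewrite /resolvent_norm eigenvalueNunit subrr.
(* This is where [0 < n] matters: the empty matrix is invertible. *)
have -> : (0 : 'M[R[i]]_n) \in unitmx = false.
  by case: (n) n0 => // m _; rewrite unitmxE det0 unitr0.
by rewrite gt0_muley.
Qed.

End WeightedResolventSup.

(** * The half-plane and the exterior of the unit disc *)

Theorem lemma3p1 (R : realType) (n : nat) (n_gt0 : (0 < n)%N) :
  ((exists A : 'M[R[i]]_n,
      ~ {for A, continuous (@kreissC R n)} /\ jumps_to_infinity (@kreissC R n) A) /\
   (exists A : 'M[R[i]]_n,
      ~ {for A, continuous (@kreissD R n)} /\ jumps_to_infinity (@kreissD R n) A)) /\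
  ((forall A : 'M[R[i]]_n,
      spectral_abscissa A < 0 -> {for A, continuous (@kreissC R n)}) /\
   (forall A : 'M[R[i]]_n,
      spectral_radius A < 1 -> {for A, continuous (@kreissD R n)})).
Proof.
split; split.
- exists 0%:M.
  suff J : jumps_to_infinity (@kreissC R n) 0%:M.
    by split => //; exact: jumps_to_infinity_discontinuous.
  apply: scalar_mx_jumps_to_infinity => // [z /= z0|e e0]; last first.
    by rewrite add0r.
  by rewrite subr0 (lt_le_trans z0) ?ler_Re_normc.
- exists 1%:M.
  suff J : jumps_to_infinity (@kreissD R n) 1%:M.
    by split => //; exact: jumps_to_infinity_discontinuous.
  have normc1B z : Normc.normc z - 1 <= Normc.normc (z - 1) :> R.
    by rewrite -[X in _ - X](Normc.normc1 R) normcB_ge.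
  apply: scalar_mx_jumps_to_infinity => // [z /= z1|e e0].
    by rewrite (lt_le_trans _ (normc1B z)) ?subr_gt0.
  have -> : 1 + e%:C%C = (1 + e)%:C%C by rewrite rmorphD.
  rewrite /= expr0n addr0 sqrtr_sqr ger0_norm ?addr_ge0 ?ltW//.
  by rewrite subr_gt0 ltrDl.
- case: n n_gt0 => // n _ A Aa.
  have Ale l : eigenvalue A l -> complex.Re l <= spectral_abscissa A.
    (* Where there is no supremum, [sup] is 0 by default, which contradicts the negative
       abscissa. *)
    have [hs|hs] := pselect (has_sup [set complex.Re z | z in spectrum A]).
      by move=> Al; apply: ub_le_sup; [case: hs|exists l].
    by move: Aa; rewrite /spectral_abscissa sup_out// ltxx.
  have ReB z l : complex.Re (z - l) = complex.Re z - complex.Re l :> R.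
    by case: z l => [? ?] [? ?].
  (* The real part of [z - l] is at least [Re z - spectral_abscissa A], which exceeds both the gap
     and the weight [Re z]. *)
  apply: (@continuous_weighted_resolvent_sup R _ _ n A (- spectral_abscissa A)).
  + by rewrite oppr_gt0.
  + by exists 1; rewrite /= ltr01.
  + by move=> z /ltW.
  + move=> z l /= z0 /Ale Al; rewrite (le_trans _ (ler_Re_normc _))// ReB; lra.
  + move=> z l /= z0 /Ale Al; rewrite (le_trans _ (ler_Re_normc _))// ReB; lra.
- case: n n_gt0 => // n _ A Aa.
  have Ale l : eigenvalue A l -> Normc.normc l <= spectral_radius A.
    (* Here the default value 0 of [sup] would not contradict the hypothesis, so the spectrum is
       shown to be bounded. *)
    move=> Al; apply: ub_le_sup; last by exists l.
    by exists (spectral_norm A) => _ [z /= Az <-]; exact: eigenvalue_le_spectral_norm.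
  (* The reverse triangle inequality bounds [normc (z - l)] below by [normc z - spectral_radius A],
     which exceeds both the gap and the weight [normc z - 1]. *)
  apply: (@continuous_weighted_resolvent_sup R _ _ n A (1 - spectral_radius A)).
  + by rewrite subr_gt0.
  + by exists 2%:C%C; rewrite /= expr0n addr0 sqrtr_sqr ger0_norm// ltr1n.
  + by move=> z /ltW; rewrite subr_ge0.
  + move=> z l /= z1 /Ale Al; rewrite (le_trans _ (normcB_ge _ _))//; lra.
  + move=> z l /= z1 /Ale Al; rewrite (le_trans _ (normcB_ge _ _))//; lra.
Qed.
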